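(* Let $A$ be adequate, $\beta\in\Gamma$, and suppose that $A$ is $\beta$-closed, i.e. for all $M\in A$, $M\cap\beta\in A$. Let $B$ be adequate such that $A\cap P(\beta)\subseteq B\subseteq P(\beta)$, where $P(\beta)$ is the power set of $\beta$. Then $A\cup B$ is adequate.
   Context: Standing assumptions and notation. Assume $2^{\omega_1}=\omega_2$ and fix a bijection $\pi:\omega_2\to H(\omega_2)$. $P_{\omega_1}(\omega_2)$ is the set of countable subsets of $\omega_2$. Assume there is a stationary set $\mathcal{Y}\subseteq P_{\omega_1}(\omega_2)$ which is thin, i.e. for all $\beta<\omega_2$ the set $\{a\cap\beta: a\in\mathcal{Y}\}$ has size at most $\omega_1$; fix such a $\mathcal{Y}$ which is moreover closed under initial segments ($a\in\mathcal{Y}$, $\beta<\omega_2$ imply $a\cap\beta\in\mathcal{Y}$). Let $\mathcal{A}$ be the structure $(H(\omega_2),\in,\pi,\mathcal{Y})$, which has definable Skolem functions (via the well-ordering induced by $\pi$). For $a\subseteq H(\omega_2)$, $Sk(a)$ is the closure of $a$ under a fixed set of definable Skolem functions for $\mathcal{A}$. Let $C$ be the (club) set of $\beta<\omega_2$ with $Sk(\beta)\cap\omega_2=\beta$, and let $\Lambda$ be the set of $\beta<\omega_2$ of cofinality $\omega_1$ which are limit points of $C$. Let $\mathcal{X}$ be the set of $M\in\mathcal{Y}$ such that $Sk(M)\cap\omega_2=M$ and for all $\gamma\in M$, $\sup(C\cap\gamma)\in M$. Comparison points and adequacy. Fix a set $\Gamma\subseteq\Lambda$ which is stationary in $\omega_2$.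 For $M\in\mathcal{X}$, $\Gamma_M$ is the set of $\beta\in\Gamma$ such that $\beta=\min(\Gamma\setminus\sup(M\cap\beta))$, i.e. $\Gamma\cap[\sup(M\cap\beta),\beta)=\emptyset$. For $M,N\in\mathcal{X}$, $\Gamma_M\cap\Gamma_N$ has a largest element, denoted $\beta_{M,N}$. A set $A\subseteq\mathcal{X}$ is adequate if for all $M,N\in A$, either $M\cap\beta_{M,N}=N\cap\beta_{M,N}$, or $M\cap\beta_{M,N}\in Sk(N)$, or $N\cap\beta_{M,N}\in Sk(M)$. *)

(* Defs.v *)
From HB Require Import structures.
From mathcomp Require Import all_boot all_classical.

Set Implicit Arguments.
Unset Strict Implicit.
Unset Printing Implicit Defensive.

Local Open Scope classical_set_scope.
Local Open Scope card_scope.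
Local Open Scope quotient_scope.

(* The universe of sets [V] is Aczel's type of well-founded trees, quotiented by
   bisimilarity.  With the classical axioms of [boolp] it satisfies ZFC (with
   Separation and Replacement for arbitrary predicates), so an element of [V] is
   a set, a term of type [set V] is a class, and a class contained in a set (or
   indexed by a small type) is the extension of a unique element of [V]. *)

Inductive tree : Type := Tree (A : Type) (f : A -> tree).

Fixpoint bisim_prop (x y : tree) : Prop :=
  match x, y with
  | Tree A f, Tree B g =>
      (forall i : A, exists j : B, bisim_prop (f i) (g j)) /\
      (forall j : B, exists i : A, bisim_prop (f i) (g j))
  end.

Definition bisim (x y : tree) : bool := `[< bisim_prop x y >].

Lemma bisim_refl : reflexive bisim.
Proof.
by move=> x; apply/asboolP; elim: x => A f IH /=; split=> i; exists i.
Qed.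

Lemma bisim_prop_sym x y : bisim_prop x y -> bisim_prop y x.
Proof.
elim: x y => A f IH [B g] /= [H1 H2]; split.
- by move=> j; have [i /IH ?] := H2 j; exists i.
- by move=> i; have [j /IH ?] := H1 i; exists j.
Qed.

Lemma bisim_sym : symmetric bisim.
Proof.
by move=> x y; apply/idP/idP => /asboolP /bisim_prop_sym ?; apply/asboolP.
Qed.

Lemma bisim_trans : transitive bisim.
Proof.
move=> y x z /asboolP xy /asboolP yz; apply/asboolP.
elim: x y z xy yz => A f IH [B g] [C h] /= [H1 H2] [K1 K2]; split.
- move=> i; have [j ij] := H1 i; have [k jk] := K1 j.
  by exists k; apply: IH ij jk.
- move=> k; have [j jk] := K2 k; have [i ij] := H2 j.
  by exists i; apply: IH ij jk.
Qed.

HB.instance Definition _ := gen_eqMixin tree.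
HB.instance Definition _ := gen_choiceMixin tree.

Canonical bisim_equiv := EquivRel bisim bisim_refl bisim_sym bisim_trans.

Definition V := {eq_quot bisim_equiv}.
HB.instance Definition _ := Choice.on V.

Definition emptyV : V := \pi_V (Tree (fun i : Empty_set => match i with end)).
HB.instance Definition _ := isPointed.Build V emptyV.

Definition inV (x y : V) : Prop :=
  match repr y with Tree A f => exists i : A, bisim (repr x) (f i) end.

Definition elts (x : V) : set V := [set y | inV y x].

(* The set with extension [P], when [P] is small (junk otherwise). *)
Definition setof (P : set V) : V := get [set x | elts x = P].

Definition subV (x y : V) : Prop := elts x `<=` elts y.
Definition interV (x y : V) : V := setof (elts x `&` elts y).
Definition powV (x : V) : set V := [set y | subV y x].
Definition cup (S : set V) : V := setof (\bigcup_(x in S) elts x).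

Lemma elts_inj : injective elts.
Proof.
move=> x y exy; rewrite -(reprK x) -(reprK y); apply/eqmodP => /=.
have exy' z : inV z x <-> inV z y 
  by rewrite -[inV z x]/(elts x z) exy.
have repr_pi t : bisim (repr (\pi_V t)) t by apply/eqmodP; rewrite reprK.
apply/asboolP; move: exy'; rewrite /inV.
case: (repr x) => A f; case: (repr y) => B g H /=; split.
- move=> i; have [H1 _] := H (\pi_V (f i)).
  have [|j Hj] := H1; first by exists i.
  by exists j; apply/asboolP; apply: bisim_trans Hj; rewrite bisim_sym.
- move=> j; have [_ H2] := H (\pi_V (g j)).
  have [|i Hi] := H2; first by exists j.
  exists i; apply/asboolP; apply: (@bisim_trans (repr (\pi_V (g j)))) => //.
  by rewrite bisim_sym.
Qed.

Lemma elts_setof_range (A : Type) (f : A -> tree) :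
  elts (setof (range (fun i => \pi_V (f i)))) = range (fun i => \pi_V (f i)).
Proof.
apply: (@getPex V [set x | elts x = range (fun i => \pi_V (f i))]).
exists (\pi_V (Tree f)); apply/seteqP.
have : bisim (repr (\pi_V (Tree f))) (Tree f) by apply/eqmodP; rewrite reprK.
rewrite /elts /inV; case: (repr _) => B g /asboolP /= [H1 H2]; split=> x /=.
- move=> [j Hj]; have [i /asboolP Hi] := H1 j; exists i => //.
  rewrite -[x]reprK; apply/esym/eqmodP; exact: bisim_trans Hj Hi.
- move=> [i _ <-]; have [j /asboolP Hj] := H2 i; exists j.
  apply: (@bisim_trans (f i)); first by apply/eqmodP; rewrite reprK.
  by rewrite bisim_sym.
Qed.

Lemma elts_setof (P : set V) (x : V) : P `<=` elts x -> elts (setof P) = P.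
Proof.
move=> Px; case E : (repr x) => [A f].
pose g (i : {i : A | P (\pi_V (f i))}) := f (sval i).
suff -> : P = range (fun i => \pi_V (g i)) by apply: elts_setof_range.
apply/seteqP; split=> y.
- move=> Py; have := Px _ Py; rewrite /elts /= /inV E => -[i Hi].
  have yi : y = \pi_V (f i) by rewrite -[LHS]reprK; apply/eqmodP.
  have Pi : P (\pi_V (f i)) by rewrite -yi.
  by exists (exist _ i Pi).
- by move=> [[i Pi] _ <-].
Qed.

(* Ordinals: von Neumann ordinals ([inV] is well-founded, so it is enough to ask
   that it is total on [a]).  For ordinals, [inV a b] is a < b, [subV a b] is
   a <= b, and the supremum of a set of ordinals is its union [cup]. *)

Definition ordV (a : V) : Prop :=
  (forall x, inV x a -> subV x a) /\
  (forall x y, inV x a -> inV y a -> inV x y \/ x = y \/ inV y x).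

Definition is_min (S : set V) (b : V) : Prop :=
  S b /\ forall c, S c -> subV b c.
Definition is_max (S : set V) (b : V) : Prop :=
  S b /\ forall c, S c -> subV c b.

(* The junk value [emptyV] is not reached below: uncountable ordinals and ordinals
   that do not inject into [omega1] exist by Hartogs, and the identity is cofinal
   in every ordinal. *)
Definition least_ord (P : V -> Prop) : V :=
  get (is_min [set a | ordV a /\ P a]).

Definition omega1 : V := least_ord (fun a => ~ countable (elts a)).
Definition omega2 : V := least_ord (fun a => ~ (elts a #<= elts omega1)).

Definition cof (b : V) : V :=
  least_ord (fun k => exists f : V -> V,
    (forall i, inV i k -> inV (f i) b) /\
    (forall a, inV a b -> exists2 i, inV i k & subV a (f i))).

Definition limit_point (E : set V) (b : V) : Prop :=
  b <> emptyV /\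
  forall a, inV a b -> exists c, [/\ E c, inV a c & inV c b].

Definition club_omega2 (E : set V) : Prop :=
  [/\ E `<=` elts omega2,
      forall a, inV a omega2 -> exists2 c, E c & inV a c &
      forall b, inV b omega2 -> limit_point E b -> E b].

Definition stationary_omega2 (S : set V) : Prop :=
  S `<=` elts omega2 /\ forall E, club_omega2 E -> S `&` E !=set0.

(* [Pcount] is P_{omega_1}(omega_2); for this power set, closure under unions of
   increasing omega-chains gives closure under all countable chains. *)
Definition Pcount : set V := [set a | subV a omega2 /\ countable (elts a)].

Definition club_Pcount (D : set V) : Prop :=
  [/\ D `<=` Pcount,
      forall a, Pcount a -> exists2 d, D d & subV a d &
      forall f : nat -> V, (forall n, D (f n)) ->
        (forall n, subV (f n) (f n.+1)) -> D (cup (range f))].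

Definition stationary_Pcount (S : set V) : Prop :=
  S `<=` Pcount /\ forall D, club_Pcount D -> S `&` D !=set0.

Definition thin (Y : set V) : Prop :=
  forall b, inV b omega2 ->
    [set interV a b | a in Y] #<= elts omega1.

Inductive tc (x : V) : V -> Prop :=
| tc_mem y : inV y x -> tc x y
| tc_step y z : tc x y -> inV z y -> tc x z.

(* H(omega_2); [~ (X #<= Y)] is |Y| < |X|. *)
Definition Homega2 : set V := [set x | ~ (elts omega2 #<= (tc x : set V))].

(* First-order formulas of the language of (H(omega_2), \in, pi, Y), with free
   variables in 'I_n.  [fEx] binds variable [ord0]. *)
Inductive form : nat -> Type :=
| fEq n (i j : 'I_n) : form n
| fIn n (i j : 'I_n) : form n
| fPi n (i j : 'I_n) : form n
| fY n (i : 'I_n) : form n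
| fNot n (p : form n) : form n
| fAnd n (p q : form n) : form n
| fEx n (p : form n.+1) : form n.

Definition scons n (x : V) (v : 'I_n -> V) : 'I_n.+1 -> V :=
  fun i => if unlift ord0 i is Some j then v j else x.

Section Structure.

Variables (pi : V -> V) (Y : set V).

Fixpoint sat n (p : form n) : ('I_n -> V) -> Prop :=
  match p in form n return ('I_n -> V) -> Prop with
  | fEq _ i j => fun v => v i = v j
  | fIn _ i j => fun v => inV (v i) (v j)
  | fPi _ i j => fun v => inV (v i) omega2 /\ pi (v i) = v j
  | fY _ i => fun v => Y (v i)
  | fNot _ p => fun v => ~ sat p v
  | fAnd _ p q => fun v => sat p v /\ sat q v
  | fEx _ p => fun v => exists2 x, Homega2 x & sat p (scons x v)
  end.

(* [ord0] is the witness variable, the other [n] variables are the arguments;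
   n = 0 is allowed, so the Skolem hull of the empty set is not empty. *)
Definition skolem_family := forall n, form n.+1 -> ('I_n -> V) -> V.

Definition definable_skolem (F : skolem_family) : Prop :=
  forall n (p : form n.+1),
    [/\ forall v, (forall i, Homega2 (v i)) -> Homega2 (F n p v),
        forall v, (forall i, Homega2 (v i)) ->
          (exists2 x, Homega2 x & sat p (scons x v)) ->
          sat p (scons (F n p v) v) &
        exists q : form n.+1, forall v x, (forall i, Homega2 (v i)) ->
          Homega2 x -> (sat q (scons x v) <-> x = F n p v)].

Variable F : skolem_family.

Inductive Sk (a : set V) : V -> Prop :=
| Sk_base x : a x -> Sk a x
| Sk_app n (p : form n.+1) (v : 'I_n -> V) :
    (forall i, Sk a (v i)) -> Sk a (F p v).

Definition Cset : set V :=
  [set b | inV b omega2 /\ Sk (elts b) `&` elts omega2 = elts b].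

Definition Lambda : set V :=
  [set b | [/\ inV b omega2, cof b = omega1 & limit_point Cset b]].

Definition Xset : set V :=
  [set M | [/\ Y M, Sk (elts M) `&` elts omega2 = elts M &
    forall g, inV g M -> inV (cup (Cset `&` elts g)) M]].

Variable Gamma : set V.

(* As ordinals are von Neumann, [Gamma `\` elts c] is the set of members of [Gamma]
   that are >= [c]; here c = sup (M \cap b). *)
Definition Gamma_ (M : V) : set V :=
  [set b | Gamma b /\ is_min (Gamma `\` elts (cup (elts (interV M b)))) b].

Definition beta_ (M N : V) : V := get (is_max (Gamma_ M `&` Gamma_ N)).

Definition adequate (A : set V) : Prop :=
  A `<=` Xset /\
  forall M N, A M -> A N ->
    let b := beta_ M N in
    [\/ interV M b = interV N b,
        Sk (elts N) (interV M b) |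
        Sk (elts M) (interV N b)].

End Structure.

(* Main.v *)
Require Import Defs.
From mathcomp Require Import all_boot all_classical.

Local Open Scope classical_set_scope.
Local Open Scope card_scope.

(* Let [M] be in [A] and [N] in [B].  As [N] is bounded by [beta], which is in
   [Gamma], no member of [Gamma_N] is above [beta]; and below [beta] the sets
   [Gamma_M] and [Gamma_(M \cap beta)] agree.  So the comparison point [b] of
   [M] and [N] is that of [M \cap beta] and [N], both of which are in [B], and
   [b <= beta].  Adequacy of [B] then compares [N \cap b] with
   [M \cap beta \cap b = M \cap b]. *)

(** This carries structural arguments on trees over to membership in the quotient [V]. *)
Lemma elts_pi (T : Type) (f : T -> tree) :
  elts (\pi_V%qT (Tree f)) = range (fun i => \pi_V%qT (f i)).
Proof.
apply/seteqP.
have : bisim (repr (\pi_V%qT (Tree f))) (Tree f) by apply/eqmodP; rewrite reprK.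
rewrite /elts /inV; case: (repr _) => B g /asboolP /= [H1 H2]; split=> x /=.
- move=> [j Hj]; have [i /asboolP Hi] := H1 j; exists i => //.
  by rewrite -[x]reprK; apply/esym/eqmodP; apply: bisim_trans Hj Hi.
- move=> [i _ <-]; have [j /asboolP Hj] := H2 i; exists j.
  apply: (@bisim_trans (f i)); first by apply/eqmodP; rewrite reprK.
  by rewrite bisim_sym.
Qed.

Lemma inV_emptyV x : ~ inV x emptyV.
Proof.
by move=> xe; have : elts emptyV x by []; rewrite elts_pi => -[[]].
Qed.

Lemma inV_ind (P : V -> Prop) :
  (forall x, (forall y, inV y x -> P y) -> P x) -> forall x, P x.
Proof.
move=> IH x; rewrite -[x]reprK; elim: (repr x) => T f IHf.
apply: IH => y yf; have : elts (\pi_V%qT (Tree f)) y by [].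
by rewrite elts_pi => -[i _ <-].
Qed.

Lemma inV_asym x y : inV x y -> ~ inV y x.
Proof. by elim/inV_ind: x y => x IH y xy yx; exact: (IH y yx x yx xy). Qed.

Lemma inV_irr x : ~ inV x x.
Proof. by move=> xx; exact: (inV_asym _ _ xx xx). Qed.

Lemma inV_acyclic3 x y z : inV x y -> inV y z -> ~ inV z x.
Proof.
by elim/inV_ind: x y z => x IH y z xy yz zx; exact: (IH z zx x y zx xy yz).
Qed.

Lemma elts_interV x y : elts (interV x y) = elts x `&` elts y.
Proof. by apply: (@elts_setof _ x) => z []. Qed.

Lemma interVA x y z : interV (interV x y) z = interV x (interV y z).
Proof. by apply: elts_inj; rewrite !elts_interV setIA. Qed.

Lemma interV_subr x y : subV y x -> interV x y = y.
Proof. by move=> yx; apply: elts_inj; rewrite elts_interV setIC; apply/setIidPl. Qed.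

Lemma subV_interl x y : subV (interV x y) x.
Proof. by rewrite /subV elts_interV => z []. Qed.

(** For [y] in [x] in [b], totality on [a] compares [y] with [b]; the cases other than [inV y b]
    give membership cycles of length two or three. *)
Lemma ordV_trans a b : ordV a -> inV b a -> forall x, inV x b -> subV x b.
Proof.
move=> [tr tot] ba x xb y yx.
have xa : inV x a := tr b ba x xb.
have ya : inV y a := tr x xa y yx.
have [//|[yb|by_]] := tot y b ya ba.
- by move: yx; rewrite yb => bx; case: (inV_asym _ _ xb bx).
- by case: (inV_acyclic3 _ _ _ yx xb by_).
Qed.

(* [least_ord] takes the junk value [emptyV] when no ordinal satisfies [P]. *)
Lemma ordV_least_ord (P : V -> Prop) : ordV (least_ord P).
Proof.
have [ex|nex] := pselect (exists b, is_min [set a | ordV a /\ P a] b).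
  by have [[]] := @getPex V (is_min [set a | ordV a /\ P a]) ex.
rewrite /least_ord getPN; last by move=> b hb; apply: nex; exists b.
by split=> x => [|y] /inV_emptyV.
Qed.

Lemma ordV_omega2 : ordV omega2.
Proof. exact: ordV_least_ord. Qed.

(** The bound [b] also makes the union small, so [cup S] is not junk. *)
Lemma subV_cup (S : set V) b : (forall x, S x -> subV x b) -> subV (cup S) b.
Proof.
move=> Sb; have Ub : \bigcup_(x in S) elts x `<=` elts b.
  by move=> z [x Sx zx]; exact: Sb Sx z zx.
by rewrite /subV /cup (@elts_setof _ b).
Qed.

Lemma Sk_mono (F : skolem_family) (a b : set V) : a `<=` b -> Sk F a `<=` Sk F b.
Proof.
move=> ab x; elim=> [{}x /ab /Sk_base //|n p v _ IH].
exact: Sk_app.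
Qed.

Section ComparisonPoint.

Variables (Gamma : set V) (beta : V).
Hypotheses (Gamma_omega2 : Gamma `<=` elts omega2) (Gamma_beta : Gamma beta).

(** If [beta] were below [g], then, since the supremum of [interV N g] is at most [beta], [beta]
    itself would compete with [g] for the minimum that defines [Gamma_]. *)
Lemma Gamma_le_bound N g : subV N beta -> Gamma_ Gamma N g -> subV g beta.
Proof.
move=> Nb [Gg [_ gmin]].
have trb := ordV_trans _ _ ordV_omega2 (Gamma_omega2 _ Gamma_beta).
have [gb|[->//|bg]] :=
  ordV_omega2.2 g beta (Gamma_omega2 _ Gg) (Gamma_omega2 _ Gamma_beta).
  exact: trb.
suff /gmin gb : (Gamma `\` elts (cup (elts (interV N g)))) beta.
  by case: (inV_irr beta); exact: gb.
split=> // bsup; apply: (inV_irr beta); apply: subV_cup bsup => x xN.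
by apply: trb; apply: Nb; exact: subV_interl xN.
Qed.

(** Cutting [M] at [beta] first does not change its trace on [g], hence not the supremum either. *)
Lemma Gamma_interV M g :
  subV g beta -> Gamma_ Gamma (interV M beta) g <-> Gamma_ Gamma M g.
Proof. by move=> gb; rewrite /Gamma_ /= interVA (interV_subr beta). Qed.

Lemma Gamma_setI_interV M N : subV N beta ->
  Gamma_ Gamma (interV M beta) `&` Gamma_ Gamma N =
  Gamma_ Gamma M `&` Gamma_ Gamma N.
Proof.
move=> Nb; apply/seteqP; split=> g [Mg Ng]; split=> //;
  by apply/(Gamma_interV M _ (Gamma_le_bound _ _ Nb Ng)).
Qed.

(** Both sides choose from the same set, so no maximum has to exist. *)
Lemma beta_interV M N : subV N beta ->
  beta_ Gamma (interV M beta) N = beta_ Gamma M N.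
Proof. by move=> Nb; rewrite /beta_ Gamma_setI_interV. Qed.

(* If the maximum did not exist, [beta_] would be the junk value [emptyV], which
   is below [beta] too. *)
Lemma beta_le_bound M N : subV N beta -> subV (beta_ Gamma M N) beta.
Proof.
move=> Nb; rewrite /beta_; set S := is_max _.
have [ex|nex] := pselect (exists b, S b).
  by have [[_ Nget] _] := @getPex V S ex; exact: Gamma_le_bound Nget.
rewrite getPN; last by move=> b Sb; apply: nex; exists b.
by move=> x /inV_emptyV.
Qed.

End ComparisonPoint.

Lemma beta_sym Gamma M N : beta_ Gamma M N = beta_ Gamma N M.
Proof. by rewrite /beta_ setIC. Qed.

Theorem proposition3p11
  (pi : V -> V) (Y : set V) (F : skolem_family) (Gamma : set V)
  (h2omega1 : powV omega1 #= elts omega2)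
  (hpi : set_bij (elts omega2) Homega2 pi)
  (hYstat : stationary_Pcount Y)
  (hYthin : thin Y)
  (hYinit : forall a b, Y a -> inV b omega2 -> Y (interV a b))
  (hF : definable_skolem pi Y F)
  (hGamma : Gamma `<=` Lambda F)
  (hGstat : stationary_omega2 Gamma)
  (A B : set V) (beta : V)
  (hA : adequate Y F Gamma A)
  (hbeta : Gamma beta)
  (hclosed : forall M, A M -> A (interV M beta))
  (hB : adequate Y F Gamma B)
  (hAB : A `&` powV beta `<=` B)
  (hBbeta : B `<=` powV beta) :
  adequate Y F Gamma (A `|` B).
Proof.
have mixed M N : A M -> B N -> let b := beta_ Gamma M N in
    [\/ interV M b = interV N b, Sk F (elts N) (interV M b) |
        Sk F (elts M) (interV N b)].
  move=> AM BN b.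
  have Nb : subV N beta := hBbeta _ BN.
  have MbE : interV (interV M beta) b = interV M b.
    by rewrite interVA (interV_subr beta) //; exact: (beta_le_bound _ _ hGstat.1).
  have BM : B (interV M beta).
    apply: hAB; split; first exact: hclosed.
    by rewrite /powV /= /subV elts_interV => z [].
  have /= := hB.2 _ _ BM BN.
  rewrite (beta_interV _ _ hGstat.1 hbeta) // -/b MbE => -[?|?|NSk].
  - exact: Or31.
  - exact: Or32.
  (* Here [NSk] concerns the hull of [interV M beta], which lies inside that of [M]. *)
  - by apply: Or33; apply: Sk_mono NSk; exact: subV_interl.
split=> [M [/hA.1|/hB.1] //|M N [AM|BM] [AN|BN]].
- exact: hA.2.
- exact: mixed.
(* Exchanging [M] and [N] swaps the last two alternatives. *)
- rewrite beta_sym /=; case: (mixed _ _ AN BM) => [/esym ?|?|?].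
  + exact: Or31.
  + exact: Or33.
  + exact: Or32.
- exact: hB.2.
Qed.
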